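(* Consider the buyer's procurement problem (P1): choose a mechanism $(\mathcal M,(q,t))$, with message space $\mathcal M$ and outcome functions $q:\mathcal M\to\mathbb R_+$, $t:\mathcal M\to\mathbb R$, so as to maximize $\mathbb E_{X,W}\{\mathcal V(q)-t\}$ (evaluated at a Bayesian Nash equilibrium $m^*$ of the game induced by the mechanism) subject to voluntary participation $$t(m^* )-\mathbb E_W\{C(q(m^* ),W,x)\}\ge 0\qquad\forall x\in\chi .$$ An optimal mechanism for the buyer is a menu of contracts (nonlinear pricing scheme): the buyer announces a payment function $t:\mathbb R_+\to\mathbb R$ of the delivered quantity, and the seller of type $x$ selects the quantity $q(x)$ to deliver and is paid $t(q(x))$, where $$p(q)\in\arg\max_{\hat p}\Big\{P\big[x\in\chi \,:\, \hat p\ge c(q,x)\big]\,\big(\mathcal V'(q)-\hat p\big)\Big\}\quad (q\ge 0),$$ $$t(q)=\int_0^q p(l)\,dl+C(0,\underline x)\quad (q\ge 0),$$ $$q(x)\in\arg\max_{l\in\mathbb R_+}\Big\{t(l)-\mathbb E_W\{C(l,W,x)\}\Big\}\quad (x\in\chi),$$ and $\mathcal V'(q)=\frac{d\mathcal V(q)}{dq}$.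
   Context: Setting. A buyer purchases a quantity $q\ge0$ of energy from a seller for a payment $t$. Buyer: risk-neutral with utility $\mathcal V(q)-t$, where $\mathcal V$ is differentiable and $\mathcal V(0)=0$. Seller: she has a type $x\in\chi\subseteq\mathbb R^n$, known only to her; $X$ denotes the random type, distributed on $\chi$ according to a commonly known prior $f_X$, and $P[\cdot]$ is probability under this prior. Her production cost is $C(q,w,x)$, where $w$ is the realization of a random variable $W$ (weather) with commonly known distribution $F_W$. $C(q,w,x)$ is convex and increasing in $q$, and $C(0,w,x)=C(0,x)=x_1$ does not depend on $w$. The seller is risk-neutral with utility $\mathbb E_W\{t-C(q,W,x)\}$; her utility from not participating is $0$. Expected marginal cost: $c(q,x)=\frac{\partial}{\partial q}\mathbb E_W\{C(q,W,x)\}$. There is $m$ with $1<m\le n$ such that $c(q,x)$ is increasing (in the weak sense) in $x_i$ for $1\le i\le m$ and decreasing (in the weak sense) in $x_i$ for $m<i\le n$. There is a worst type $\underline x\in\chi$ such that $\underline x_i\ge x_i$ for $1\le i\le m$ and $\underline x_j\le x_j$ for $m<j\le n$, for all $x\in\chi$. Both parties are strategic and perfectly rational, and this is common knowledge. The buyer has all the bargaining power (he designs the mechanism). The seller decides whether to accept before $W$ is realized, and once she accepts, both parties are fully committed to the rules of the mechanism. The voluntary participation constraint is required for every type in $\chi$. Regularity assumption of the paper: for the payment functions $t$ under consideration, the seller's problem $\max_{l\ge0}\{t(l)-\mathbb E_W\{C(l,W,x)\}\}$ is continuous and quasi-concave in $l$, so that it is characterized by its first-order condition; thus, with marginal price $p(q)=\frac{\partial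 t(q)}{\partial q}$, type $x$ is willing to produce at least $l$ if and only if $p(l)\ge c(l,x)$. The maximizers in the formulas are taken to exist, with all integrals and expectations well defined.
   Formalization: The quantity q(x) is taken to be the largest maximizer of the seller's problem; with an arbitrary choice from the argmax the claim fails (one type, p = c on an interval, q(x) = 0). *)

(* Defs.v *)
From HB Require Import structures.
From mathcomp Require Import all_boot all_order all_algebra.
From mathcomp Require Import all_classical all_reals all_analysis.
Set Implicit Arguments.
Unset Strict Implicit.
Unset Printing Implicit Defensive.
Import Order.TTheory GRing.Theory Num.Theory.
Import numFieldNormedType.Exports.
Local Open Scope classical_set_scope.
Local Open Scope ring_scope.

(* Derivative of a function of a quantity q >= 0: only increments h with
   0 <= q + h are used, so it is the usual derivative when 0 < q and the right
   derivative when q = 0.  Values of f at negative arguments are irrelevant. *)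
Definition diff_quotient {R : realType} (f : R -> R) (q : R) : R -> R :=
  fun h => h^-1 * (f (q + h) - f q).

Definition hderivable {R : realType} (f : R -> R) (q : R) : Prop :=
  cvg (diff_quotient f q h @[h --> within [set h | 0 <= q + h] 0^']).

Definition hderive {R : realType} (f : R -> R) (q : R) : R :=
  lim (diff_quotient f q h @[h --> within [set h | 0 <= q + h] 0^']).

Definition quasi_concave {R : realType} (f : R -> R) : Prop :=
  forall a l b, 0 <= a -> a <= l -> l <= b -> Num.min (f a) (f b) <= f l.

(* Types are vectors of R^n, represented by n.-tuple R because that type carries
   the product (Borel) sigma-algebra.  The prior is the law of [rtype]; the
   weather law F_W is the law of [weather]. *)
Record environment (R : realType) (d d' : measure_display)
    (Omega : measurableType d) (Wth : measurableType d')
    (P : probability Omega R) (n : nat) := Environment {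
  types : set (n.-tuple R) ;
  rtype : {RV P >-> n.-tuple R} ;
  weather : {RV P >-> Wth} ;
  value : R -> R ;
  cost : R -> Wth -> n.-tuple R -> R ;
  worst : n.-tuple R }.

(* The set of messages is arbitrary. *)
Record mechanism (R : realType) := Mechanism {
  message : Type ;
  quantity : message -> {nonneg R} ;
  payment : message -> R }.

Definition menu {R : realType} (t : R -> R) : mechanism R :=
  @Mechanism R {nonneg R} id (fun l => t l%:num).

(* x is at most as costly as y: the coordinates i < m (the first m ones, since
   ordinals start at 0) raise the marginal cost, the other ones lower it. *)
Definition type_le {R : realType} {n : nat} (m : nat) (x y : n.-tuple R) : Prop :=
  forall i : 'I_n, if (i < m)%N then tnth x i <= tnth y i
                   else tnth y i <= tnth x i.

Section Environment.
Context {R : realType} {d d' : measure_display} {Omega : measurableType d}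
  {Wth : measurableType d'} {P : probability Omega R} {n : nat}
  (E : environment Wth P n).
Implicit Types (T p : R -> R) (x : n.-tuple R) (q l : R).

Definition expected_cost q x : R :=
  \int[distribution P (weather E)]_w cost E q w x.

Definition marginal_cost q x : R := hderive (expected_cost ^~ x) q.

Definition acceptance q (phat : R) : R :=
  fine (P [set w | marginal_cost q (rtype E w) <= phat]).

Record standing_assumptions (m : nat) : Prop := {
  m_range : (1 < m <= n)%N ;
  value_diff : forall q, 0 <= q -> hderivable (value E) q ;
  value0 : value E 0 = 0 ;
  rtype_in : forall w, types E (rtype E w) ;
  cost_integrable : forall q x, 0 <= q -> types E x ->
    (distribution P (weather E)).-integrable setT
      (fun w => (cost E q w x)%:E) ;
  cost_convex : forall w x, types E x ->
    convex_function (`[0, +oo[ : set R^o) (fun q : R^o => cost E q w x) ;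
  cost_incr : forall w x q1 q2, types E x -> 0 <= q1 -> q1 <= q2 ->
    cost E q1 w x <= cost E q2 w x ;
  cost0 : forall w x (i : 'I_n), types E x -> i = 0%N :> nat ->
    cost E 0 w x = tnth x i ;
  expected_cost_diff : forall q x, 0 <= q -> types E x ->
    hderivable (expected_cost ^~ x) q ;
  marginal_cost_mono : forall q x y, 0 <= q -> types E x -> types E y ->
    type_le m x y -> marginal_cost q x <= marginal_cost q y ;
  worst_in : types E (worst E) ;
  worst_ge : forall x, types E x -> type_le m x (worst E) ;
  (* the events whose probability enters the pricing formula are events *)
  acceptance_measurable : forall q phat, 0 <= q ->
    measurable [set w | marginal_cost q (rtype E w) <= phat] }.

Definition best_quantity T x q : Prop :=
  0 <= q /\
  forall l, 0 <= l -> T l - expected_cost l x <= T q - expected_cost q x.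

Definition willing T x l : Prop := exists2 q, l <= q & best_quantity T x q.

(* T is a payment function with marginal price p.  As p may jump, p = dT/dq is
   read in integral form.  The equivalence is only stated for l > 0, because
   every type is trivially willing to produce at least 0. *)
Record regular_payment T p : Prop := {
  price_integrable : forall l, 0 <= l ->
    (@lebesgue_measure R).-integrable `[0, l] (EFin \o p) ;
  payment_price : forall l, 0 <= l ->
    T l = T 0 + \int[@lebesgue_measure R]_(s in `[0, l]) p s ;
  seller_continuous : forall x, types E x ->
    {within `[0, +oo[, continuous (fun l => T l - expected_cost l x)} ;
  seller_quasi_concave : forall x, types E x ->
    quasi_concave (fun l => T l - expected_cost l x) ;
  seller_first_order : forall x l, types E x -> 0 < l ->
    (willing T x l <-> marginal_cost l x <= p l) }.

Section Game.
Context (M : mechanism R) (s : n.-tuple R -> message M).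

Definition seller_utility (msg : message M) x : R :=
  payment msg - expected_cost (quantity msg)%:num x.

(* The seller is the only player of the induced game, so a Bayesian Nash
   equilibrium is a strategy that is optimal for every type. *)
Definition equilibrium : Prop := forall x, types E x ->
  forall msg, seller_utility msg x <= seller_utility (s x) x.

Definition voluntary_participation : Prop := forall x, types E x ->
  0 <= seller_utility (s x) x.

(* The regularity assumption for a general mechanism: its equilibrium outcome
   is that of some regular payment function.  A payment function on the
   quantities chosen in equilibrium always exists (two types choosing the same
   quantity are paid the same); what is assumed is that it extends to a regular
   one on the whole half-line without changing the seller's choices. *)
Definition regular_outcome : Prop := exists T p : R -> R,
  regular_payment T p /\
  forall x, types E x ->
    best_quantity T x (quantity (s x))%:num /\
    payment (s x) = T (quantity (s x))%:num.

Definition measurable_outcome : Prop :=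
  measurable_fun setT (fun w => (quantity (s (rtype E w)))%:num) /\
  measurable_fun setT (fun w => payment (s (rtype E w))).

Definition feasible : Prop :=
  [/\ measurable_outcome, equilibrium, voluntary_participation
    & regular_outcome].

Definition buyer_payoff : \bar R :=
  'E_P[fun w => value E (quantity (s (rtype E w)))%:num
                - payment (s (rtype E w))].

End Game.

Definition optimal (M : mechanism R) (s : n.-tuple R -> message M) : Prop :=
  feasible s /\
  forall (M' : mechanism R) (s' : n.-tuple R -> message M'),
    feasible s' -> (buyer_payoff s' <= buyer_payoff s)%E.

End Environment.

(* Main.v *)
Require Import Defs.
From mathcomp Require Import all_boot all_order all_algebra.
From mathcomp Require Import all_classical all_reals all_analysis.
From mathcomp Require Import measurable_realfun ring lra.
Import Order.TTheory GRing.Theory Num.Theory.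
Import numFieldNormedType.Exports.
Local Open Scope classical_set_scope.
Local Open Scope ring_scope.

(* Write V' for the derivative of the value, K for the cost of the worst type at
   quantity 0 and G(l) for the probability that the seller delivers at least l.
   The payoff of a price schedule is -K + \int G (V' - p), so it is maximized
   pointwise in l.  For a rival mechanism the payments dominate those of a price
   schedule p' which starts at K and makes type x accept the l-th unit whenever
   x delivers at least l, hence G' (V' - p')^+ <= acceptance(p') (V' - p')^+ <=
   G (V' - p)^+ at every l > 0.

   Since V is only differentiable, V' need not be integrable and V need not be
   absolutely continuous.  The link between V(b) - V(a) and the integral of
   (V' - p)^+ therefore rests on the following fact: if the upper right Dini
   derivative of a continuous V is at most an integrable u at every interior
   point of [a, b], then V(b) - V(a) <= \int_a^b u (Vitali-Caratheodory). *)

(** * Increments of a function and integrals of bounds on its right derivatives *)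

Lemma measure_subset d (T : measurableType d) (R : realType)
    (mu : {measure set T -> \bar R}) (A B : set T) :
  measurable A -> measurable B -> A `<=` B -> (mu A <= mu B)%E.
Proof. by move=> mA mB; apply: le_measure; rewrite inE. Qed.

(* Adding r to u + e gives a majorant which near each point x exceeds a constant
   larger than u x: layer k of u is {k e <= u < (k + 1) e}, and r adds
   (k + 1) e on an open neighbourhood of layer k of slightly larger measure. *)
Lemma open_layers_majorant (R : realType) (D : set R) (u : R -> R) (e : R) :
  measurable D -> (lebesgue_measure D < +oo)%E -> measurable_fun D u ->
  (forall x, D x -> 0 <= u x) -> 0 < e ->
  exists r : R -> \bar R,
  [/\ measurable_fun setT r, (forall x, 0 <= r x)%E,
      (\int[lebesgue_measure]_(x in D) r x <= e%:E)%E &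
      forall x, D x -> exists2 M, u x < M &
        \forall y \near x, D y -> (M%:E <= (u y + e)%:E + r y)%E].
Proof.
move=> mD Dfin mu u0 e0.
pose E k := D `&` u @^-1` `[k%:R * e, k.+1%:R * e[.
have mE k : measurable (E k) by exact: mu.
have Efin k : (lebesgue_measure (E k) < +oo)%E.
  by apply: le_lt_trans Dfin; apply: measure_subset; [exact: mE|exact: mD|move=> x []].
(* With this bound layer [k] adds at most [(k + 1) * e * del k = e / 2 ^ (k + 1)] to the integral of
   [r], and these terms sum to [e]. *)
pose del k : R := (k.+1%:R * 2 ^+ k.+1)^-1.
have del0 k : 0 < del k by rewrite invr_gt0 mulr_gt0 ?exprn_gt0.
have /choice [U HU] : forall k, exists U : set R,
    [/\ open U, E k `<=` U & (lebesgue_measure (U `\` E k) < (del k)%:E)%E].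
  move=> k; have := @lebesgue_regularity_outer R (E k) (del k); apply; [exact: mE|exact: Efin|exact: del0].
have mUE k : measurable (U k `\` E k).
  by have [oU _ _] := HU k; apply: measurableD (mE k); exact: open_measurable.
pose f k x : \bar R := ((k.+1%:R * e) * \1_(U k `\` E k) x)%:E.
have mf k : measurable_fun setT (f k).
  by apply/measurable_EFinP; apply: measurable_funM.
have f0 k x : (0 <= f k x)%E by rewrite lee_fin mulr_ge0// mulr_ge0// ltW.
exists (fun x => \sum_(k <oo) f k x)%E; split.
- exact: ge0_emeasurable_sum.
- by move=> x; apply: nneseries_ge0.
- rewrite integral_nneseries//; last by move=> n; apply: measurable_funTS; exact: mf.
  apply: (@le_trans _ _ (\sum_(k <oo) (e / 2 ^+ k.+1)%:E)%E).
    apply: lee_nneseries => [k _ _|k _]; first by apply: integral_ge0.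
    apply: (@le_trans _ _ ((k.+1%:R * e)%:E * (del k)%:E)%E); last first.
      by rewrite lee_fin /del invfM mulrACA mulfV// mul1r.
    rewrite /f; under eq_integral do rewrite EFinM.
    rewrite ge0_integralZl//; last 2 first.
    - by apply: measurable_funTS; apply/measurable_EFinP; apply: measurable_indic; exact: mUE.
    - by rewrite lee_fin mulr_ge0// ltW.
    rewrite lee_wpmul2l//; first by rewrite lee_fin mulr_ge0// ltW.
    rewrite integral_indic//; last exact: mUE.
    have [_ _ /ltW] := HU k; apply: le_trans.
    by apply: measure_subset; [exact: (measurableI _ _ (mUE k) mD)|exact: mUE|exact: subIsetl].
  by have := epsilon_trick0 xpredT (ltW e0); under eq_eseriesr do rewrite natrX.
- move=> x Dx.
  pose k := Num.truncn (u x / e).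
  have ue0 : 0 <= u x / e by rewrite divr_ge0 ?u0 // ltW.
  have /andP[kl ku] := truncn_itv ue0.
  have Ekx : E k x.
    split=> //=; rewrite in_itv/= -ler_pdivlMr// kl/=.
    by rewrite -ltr_pdivrMr.
  exists (k.+1%:R * e); first by case: Ekx => _ /=; rewrite in_itv/= => /andP[].
  have [oU EU _] := HU k.
  have : \forall y \near x, U k y by apply: open_nbhs_nbhs; split => //; exact: EU.
  apply: filterS => y Uy Dy.
  (* While [y] stays in layer [k], [u y + e] alone reaches [(k + 1) * e]; once [y] leaves the layer
     inside [U k], term [k] of [r] supplies that constant. *)
  have [[_ /=]|nEy] := pselect (E k y).
    rewrite in_itv/= => /andP[ky _]; rewrite -[leLHS]adde0.
    apply: leeD; last exact: nneseries_ge0.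
    by rewrite lee_fin -natr1 mulrDl mul1r lerD2r.
  rewrite -[leLHS]add0e; apply: leeD.
    by rewrite lee_fin addr_ge0 ?u0 // ltW.
  apply: (@le_trans _ _ (f k y)).
    by rewrite /f indicE mem_set ?mulr1.
  have := @nneseries_lim_ge R (f ^~ y) xpredT 0 k.+1 (fun n _ _ => f0 n y).
  apply: le_trans; rewrite big_nat_recr //= leeDr //.
  by apply: sume_ge0 => i _; exact: f0.
Qed.

(** Near each point the majorant [w = u + e1 + r] exceeds a constant larger than the value of [u]
    there, so over a short interval to the right its integral covers the increment of [V]. This
    carries the bound from left to right, up to an error that can be made arbitrarily small. *)
Lemma increment_le_integral_ge0 (R : realType) (a b : R) (V u : R -> R) :
  a <= b -> {within `[a, b], continuous V} ->
  (forall x, a <= x <= b -> 0 <= u x) ->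
  (@lebesgue_measure R).-integrable `[a, b] (EFin \o u) ->
  (forall x, a < x < b -> forall e : R, 0 < e ->
    \forall h \near 0^'+, V (x + h) - V x <= (u x + e) * h) ->
  V b - V a <= \int[@lebesgue_measure R]_(x in `[a, b]) u x.
Proof.
have shift (x y z k1 k2 : R) : x - y < z -> x - k1 - k2 <= y - k1 - k2 + z.
  by move=> ?; lra.
rewrite le_eqVlt => /predU1P[->|ab] cV u0 iu dV.
  rewrite subrr; apply: Rintegral_ge0 => x /=; rewrite in_itv /=; exact: u0.
have mab (x y : R) (b1 b2 : bool) :
  measurable [set` Interval (BSide b1 x) (BSide b2 y)] by exact: measurable_itv.
have mu : measurable_fun `[a, b] u by apply/measurable_EFinP; exact: measurable_int iu.
apply/ler_addgt0Pr => e e0.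
have ba0 : 0 < b - a by rewrite subr_gt0.
(* The error [e] is shared out: [e1 * (b - a)] for the constant added to [u], [e1] for the integral
   of [r], and [e1] for the slack in [S]. *)
pose e1 := e / (b - a + 2).
have e10 : 0 < e1 by rewrite divr_gt0 // addr_gt0.
have Dfin : (lebesgue_measure `[a, b]%classic < +oo)%E.
  by rewrite lebesgue_measure_itv /= lte_fin ab -EFinB ltry.
have u0' x : `[a, b]%classic x -> 0 <= u x by rewrite /= in_itv /=; exact: u0.
have [r [mr r0 ir lsc]] := open_layers_majorant R _ u e1 (mab a b true false) Dfin mu u0' e10.
pose w x : \bar R := ((u x + e1)%:E + r x)%E.
have mw : measurable_fun `[a, b] w.
  apply: emeasurable_funD; last exact: measurable_funTS.
  by apply/measurable_EFinP; exact: measurable_funD.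
have w0 x : `[a, b]%classic x -> (0 <= w x)%E.
  by move=> Dx; rewrite adde_ge0 // lee_fin addr_ge0 ?u0' // ltW.
pose W s := (\int[@lebesgue_measure R]_(x in `[a, s]) w x)%E.
have sab s : s <= b -> `[a, s]%classic `<=` `[a, b]%classic.
  by move=> sb; apply: subset_itvl; rewrite bnd_simp.
have Wb : (W b <= (\int[@lebesgue_measure R]_(x in `[a, b]) u x + e1 * (b - a) + e1)%:E)%E.
  rewrite /W ge0_integralD //; last 3 first.
  - by move=> x Dx; rewrite lee_fin addr_ge0 ?u0' // ltW.
  - by apply/measurable_EFinP; exact: measurable_funD.
  - exact: measurable_funTS.
  rewrite EFinD; apply: leeD => //.
  under eq_integral do rewrite EFinD.
  rewrite ge0_integralD //; last 2 first.
  - exact: measurable_int iu.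
  - by move=> x _; rewrite lee_fin ltW.
  rewrite EFinD; apply: leeD.
    by rewrite /Rintegral fineK //; exact: integrable_fin_num iu.
  rewrite integral_cst; last exact: mab.
  by rewrite /= lebesgue_measure_itv /= lte_fin ab -EFinB.
have W0 s : s <= b -> (0 <= W s)%E.
  by move=> sb; apply: integral_ge0 => x Dx; apply: w0; exact: sab Dx.
have Wmono s s' : s <= s' -> s' <= b -> (W s <= W s')%E.
  move=> ss' s'b; apply: ge0_subset_integral; [exact: mab|exact: mab|..].
  - apply: measurable_funS mw; [exact: mab|exact: sab].
  - by move=> x Dx; apply: w0; exact: sab Dx.
  - by apply: subset_itvl; rewrite bnd_simp.
(* Real induction: the supremum of S belongs to S and cannot lie below b. *)
pose S := [set s | a <= s <= b /\ ((V s - V a - e1)%:E <= W s)%E].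
have Sa : S a.
  split; first by rewrite lexx ltW.
  by apply: (le_trans _ (W0 _ (ltW ab))); rewrite lee_fin subrr sub0r oppr_le0 ltW.
have hS : has_sup S.
  by split; [exists a|exists b => s [/andP[]]].
pose c := sup S.
have cb : c <= b by apply: ge_sup; [exists a|move=> s [/andP[]]].
have ac : a <= c by apply: ub_le_sup => //; case: hS.
have cVn x (xab : a <= x <= b) eta : 0 < eta ->
    exists2 d, 0 < d & forall s, a <= s <= b -> `|x - s| < d -> `|V x - V s| < eta.
  move=> eta0.
  have Dx : `[a, b]%classic x by rewrite /= in_itv.
  have /cvgr_dist_lt/(_ _ eta0)/nbhs_ballP[d /= d0 Hd] :=
    (subspace_continuousP _ _).1 cV x Dx.
  by exists d => // s sab' xs; apply: Hd => //; rewrite /= in_itv.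
(* [V] is continuous and [W] nondecreasing, so the bound passes to [c] from members of [S] just
   below it. *)
have Sc : S c.
  split; first by rewrite ac.
  apply/lee_addgt0Pr => eta eta0.
  have [|d d0 Hd] := cVn c _ _ eta0; first by rewrite ac.
  have [s Ss cs] := sup_adherent d0 hS.
  have sc : s <= c by apply: ub_le_sup => //; case: hS.
  have [sab' Vs] := Ss.
  have := Hd _ sab'; rewrite ger0_norm ?subr_ge0 // ltrBlDl -ltrBlDr => /(_ cs).
  move=> /ltr_normlW Vcs.
  apply: le_trans (leeD (le_trans Vs (Wmono _ _ sc cb)) (lexx _)).
  by rewrite -EFinD lee_fin; exact: shift.
suff cEb : c = b.
  case: Sc => _; rewrite cEb => Vb.
  have := le_trans Vb Wb; rewrite lee_fin => H.
  have -> : e = e1 * (b - a) + e1 + e1.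
    by rewrite -addrA -mulr2n -mulr_natr -mulrDr /e1 divfK // gt_eqF // addr_gt0.
  by move: H; rewrite lerBlDr -!addrA.
apply/eqP; rewrite eq_le cb leNgt; apply/negP => ltcb.
suff [y cy [yab Sy]] : exists2 y, c < y & S y.
  by have := @ub_le_sup R S (proj2 hS) y (conj yab Sy); rewrite leNgt cy.
have bc0 : 0 < b - c by rewrite subr_gt0.
(* The slope bound concerns interior points only; at [a] the continuity of [V] and the slack [e1]
   give the first step. *)
case: (leP c a) => [ca|ltac].
  have cEa : c = a by apply/eqP; rewrite eq_le ca.
  have [|d d0 Hd] := cVn c _ _ e10; first by rewrite ac.
  near (0 : R)^'+ => h.
  have h0 : 0 < h by [].
  have hb : c + h <= b by rewrite -lerBrDl; near: h; exact: nbhs_right_le.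
  exists (c + h); first by rewrite ltrDl.
  have chab : a <= c + h <= b by rewrite hb andbT cEa lerDl ltW.
  split=> //; apply: (le_trans _ (W0 _ hb)); rewrite lee_fin.
  have /Hd : a <= c + h <= b by [].
  rewrite opprD addrA subrr sub0r normrN gtr0_norm // => /(_ _)/wrap[].
    by near: h; exact: nbhs_right_lt.
  by rewrite distrC -cEa subr_le0 => /ltr_normlW /ltW.
have Dc : `[a, b]%classic c by rewrite /= in_itv /= ac.
have [M uM /nbhs_ballP[d /= d0 Hd]] := lsc c Dc.
have Mu0 : 0 < M - u c by rewrite subr_gt0.
have cab : a < c < b by rewrite ltac.
near (0 : R)^'+ => h.
have h0 : 0 < h by [].
have hb : c + h <= b by rewrite -lerBrDl; near: h; exact: nbhs_right_le.
have hd : h < d by near: h; exact: nbhs_right_lt.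
(* The gap [M - u c] serves as the tolerance, so [V] rises at slope at most [M], while [w] is at
   least [M] on the same short interval. *)
have dVh : V (c + h) - V c <= (u c + (M - u c)) * h by near: h; exact: dV.
exists (c + h); first by rewrite ltrDl.
split; first by rewrite hb andbT (le_trans ac) // lerDl ltW.
have UE : `[a, c + h]%classic = `[a, c]%classic `|` `]c, c + h]%classic.
  by rewrite -itv_bndbnd_setU ?bnd_simp // lerDl ltW.
have subU : `[a, c + h]%classic `<=` `[a, b]%classic by exact: sab.
have -> : W (c + h) = (W c + \int[@lebesgue_measure R]_(x in `]c, (c + h)%R]) w x)%E.
  rewrite /W UE ge0_integral_setU //; rewrite -?UE.
  - exact: measurable_funS mw.
  - by move=> x /subU; exact: w0.
  - apply/disj_setPS => x [] /=; rewrite !in_itv /= => /andP[_ xc] /andP[].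
    by rewrite ltNge xc.
case: Sc => _ Vc.
have -> : V (c + h) - V a - e1 = (V c - V a - e1) + (V (c + h) - V c) by ring.
rewrite EFinD; apply: leeD => //.
apply: (@le_trans _ _ (\int[@lebesgue_measure R]_(x in `]c, (c + h)%R]) (cst M%:E x))%E).
  rewrite integral_cst; last exact: mab.
  rewrite /= lebesgue_measure_itv /= lte_fin ltrDl h0 -EFinB -EFinM lee_fin.
  by move: dVh; rewrite subrKC addrAC subrr add0r.
have subR : `]c, c + h]%classic `<=` `[a, b]%classic.
  by move=> x Dx; apply: subU; rewrite UE; right.
apply: ge0_le_integral => //.
- move=> x _; rewrite lee_fin (le_trans _ (ltW uM)) // u0 // ac.
- exact: measurable_funS mw.
- move=> x /[dup] Dx /=; rewrite in_itv /= => /andP[cx xh].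
  apply: Hd; last by have := subR x Dx.
  by rewrite /ball /= distrC ger0_norm ?subr_ge0 1?ltW // ltrBlDl (le_lt_trans xh) // ltrD2l.
Unshelve. all: by end_near.
Qed.

Lemma bounded_integrable_itv (R : realType) (a b M : R) (f : R -> R) :
  measurable_fun `[a, b] f -> (forall x, a <= x <= b -> `|f x| <= M) ->
  (@lebesgue_measure R).-integrable `[a, b] (EFin \o f).
Proof.
move=> mf fM; apply: measurable_bounded_integrable => //.
  rewrite /= lebesgue_measure_itv /=; case: ifP => _; last exact: ltry.
  by rewrite -EFinB ltry.
exists M; split; first exact: num_real.
by move=> y My x /=; rewrite in_itv /= => xab; rewrite (le_trans (fM x xab)) // ltW.
Qed.

Lemma increment_le_integral (R : realType) (a b : R) (V u : R -> R) :
  a <= b -> {within `[a, b], continuous V} ->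
  (@lebesgue_measure R).-integrable `[a, b] (EFin \o u) ->
  (forall x, a < x < b -> forall e : R, 0 < e ->
    \forall h \near 0^'+, V (x + h) - V x <= (u x + e) * h) ->
  V b - V a <= \int[@lebesgue_measure R]_(x in `[a, b]) u x.
Proof.
have maxE (z : R) : Num.max z 0 = z + Num.max (- z) 0.
  by case: (leP z 0) => [z0|/ltW z0]; [rewrite max_l ?subrr ?oppr_ge0|
    rewrite max_r ?addr0 // oppr_le0].
move=> ab cV iu dV.
pose mu := @lebesgue_measure R.
have mD : measurable (`[a, b]%classic : set (measurableTypeR R)) by [].
have ic k : mu.-integrable `[a, b] (EFin \o cst k).
  by apply: (@bounded_integrable_itv _ _ _ `|k|).
(* Truncate u at -n and shift by n; the truncation error f n vanishes in the limit. *)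
pose f n x : R := Num.max (- (u x + n%:R)) 0.
have iun n : mu.-integrable `[a, b] (EFin \o (fun x => u x + n%:R)).
  by have := integrableD mD iu (ic n%:R); apply: eq_integrable.
have iup n : mu.-integrable `[a, b] (EFin \o (fun x => Num.max (u x + n%:R) 0)).
  exact: (integrable_funrpos mD (iun n)).
have ifn n : mu.-integrable `[a, b] (EFin \o f n).
  exact: (integrable_funrneg mD (iun n)).
have key n : ((V b - V a - \int[mu]_(x in `[a, b]) u x)%:E <=
    \int[mu]_(x in `[a, b]) (f n x)%:E)%E.
  (* The linear term lifts the slope bound from [u] to [u + n]. Its positive part is a larger,
     nonnegative bound, and equals [u + n + f n]. *)
  have := @increment_le_integral_ge0 R a b (fun x => V x + n%:R * x) _ ab _ _ (iup n).
  have -> : \int[mu]_(x in `[a, b]) Num.max (u x + n%:R) 0 =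
      \int[mu]_(x in `[a, b]) u x + n%:R * (b - a) + \int[mu]_(x in `[a, b]) f n x.
    have -> : n%:R * (b - a) = \int[mu]_(x in `[a, b]) (cst n%:R x).
      rewrite Rintegral_cst //= lebesgue_measure_itv /= lte_fin.
      case: ltP => [_|]; first by rewrite -EFinB.
      by move=> ba; have -> : b = a; [apply/eqP; rewrite eq_le ab ba|rewrite subrr].
    rewrite -RintegralD // -RintegralD //; last exact: iun.
    by apply: eq_Rintegral => x _; rewrite /f /=.
  have -> : (\int[mu]_(x in `[a, b]) (f n x)%:E)%E = (\int[mu]_(x in `[a, b]) f n x)%:E.
    by rewrite /Rintegral fineK //; exact: integrable_fin_num (ifn n).
  move=> H; rewrite lee_fin lerBlDl.
  rewrite -(lerD2r (n%:R * (b - a))) addrAC.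
  rewrite [leRHS]addrAC.
  apply: le_trans (H _ _ _).
  - by rewrite mulrBr opprD addrACA addrAC.
  - move=> x; apply: continuousD; first exact: cV.
    by apply: continuous_subspaceT; exact: mulrl_continuous.
  - by move=> x _; rewrite le_max lexx orbT.
  - move=> x xab e e0; near=> h.
    have h0 : 0 < h by [].
    have -> : V (x + h) + n%:R * (x + h) - (V x + n%:R * x) =
      V (x + h) - V x + n%:R * h by ring.
    apply: (@le_trans _ _ ((u x + e) * h + n%:R * h)).
      by rewrite lerD2r; near: h; exact: dV.
    by rewrite -mulrDl ler_wpM2r ?(ltW h0) // addrAC lerD2r le_max lexx.
(* At each [x] the error [f n] vanishes once [n >= - u x], and it is dominated by the absolute value
   of [u]. *)
have [|||||_ _] := @dominated_convergence _ _ _ mu _ mD (fun n x => (f n x)%:E) (cst 0%E) (abse \o (EFin \o u)).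
- by move=> n; exact: measurable_int (ifn n).
- exact: measurable_cst.
- apply: aeW => x _; apply/fine_cvgP; split; first by apply: nearW.
  apply: cvg_near_cst; near=> n; rewrite /f /= max_r // oppr_le0 -lerBlDl sub0r.
  by near: n; exact: nbhs_infty_ger.
- exact: integrable_abse iu.
- apply: aeW => x n _ /=; rewrite lee_fin ger0_norm ?le_max ?lexx ?orbT // /f.
  rewrite ge_max normr_ge0 andbT opprD -[leRHS]addr0 lerD // ?oppr_le0 //.
  by rewrite -normrN ler_norm.
rewrite integral0 => cf; rewrite -subr_le0 -lee_fin.
rewrite [leRHS](_ : _ = limn (fun n => \int[mu]_(x in `[a, b]) (f n x)%:E)%E).
  apply: lime_ge; first by apply/cvg_ex; exists 0%E.
  by apply: nearW => n; exact: key.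
by apply/esym/cvg_lim.
Unshelve. all: by end_near.
Qed.

(** [D] may fail to be integrable, so its excess over [p] is first capped at [n]. Since [p <= D],
    the capped sum [p + g n] stays below [D]; hence [- V] has slopes at most the integrable
    [- (p + g n)], and monotone convergence removes the cap. *)
Lemma excess_le_increment (R : realType) (a b : R) (V D p : R -> R) :
  a <= b -> {within `[a, b], continuous V} -> measurable_fun `[a, b] D ->
  (@lebesgue_measure R).-integrable `[a, b] (EFin \o p) ->
  (forall x, a < x < b -> diff_quotient V x h @[h --> 0^'+] --> D x) ->
  (forall x, a < x < b -> p x <= D x) ->
  (\int[@lebesgue_measure R]_(x in `[a, b]) (Num.max (D x - p x) 0)%:E <=
   (V b - V a - \int[@lebesgue_measure R]_(x in `[a, b]) p x)%:E)%E.
Proof.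
move=> ab cV mD ip dV pD.
pose mu := @lebesgue_measure R.
have mab : measurable (`[a, b]%classic : set (measurableTypeR R)) by [].
have mp : measurable_fun `[a, b] p by apply/measurable_EFinP; exact: measurable_int ip.
pose f x : R := Num.max (D x - p x) 0.
have f0 x : 0 <= f x by rewrite le_max lexx orbT.
have mf : measurable_fun `[a, b] f.
  by apply: measurable_maxr; [exact: measurable_funB|exact: measurable_cst].
pose g n x : R := Num.min (f x) n%:R.
have g0 n x : 0 <= g n x by rewrite le_min f0 ler0n.
have mg n : measurable_fun `[a, b] (g n).
  by apply: measurable_minr => //; exact: measurable_cst.
have ig n : mu.-integrable `[a, b] (EFin \o g n).
  apply: (@bounded_integrable_itv _ _ _ n%:R) => // x _.
  by rewrite ger0_norm // ge_min lexx orbT.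
have key n : (\int[mu]_(x in `[a, b]) (g n x)%:E <=
    (V b - V a - \int[mu]_(x in `[a, b]) p x)%:E)%E.
  have -> : (\int[mu]_(x in `[a, b]) (g n x)%:E)%E = (\int[mu]_(x in `[a, b]) g n x)%:E.
    by rewrite /Rintegral fineK //; exact: integrable_fin_num (ig n).
  rewrite lee_fin.
  have ipg : mu.-integrable `[a, b] (EFin \o (fun x => p x + g n x)).
    by have := integrableD mab ip (ig n); apply: eq_integrable.
  have iNpg : mu.-integrable `[a, b] (EFin \o (fun x => - (p x + g n x))).
    by have := integrableN ipg; apply: eq_integrable.
  have := @increment_le_integral R a b (fun x => - V x) _ ab _ iNpg.
  have -> : \int[mu]_(x in `[a, b]) (- (p x + g n x)) =
     - (\int[mu]_(x in `[a, b]) p x + \int[mu]_(x in `[a, b]) g n x).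
    rewrite -RintegralD //.
    rewrite -mulN1r -RintegralZl //.
    by apply: eq_Rintegral => x _; rewrite mulN1r.
  move=> H.
  suff : - V b - - V a <= - (\int[mu]_(x in `[a, b]) p x + \int[mu]_(x in `[a, b]) g n x).
    by move: (\int[mu]_(x in `[a, b]) p x) (\int[mu]_(x in `[a, b]) g n x) => I J; lra.
  apply: H.
  - by move=> x; apply: continuousN; exact: cV.
  - move=> x xab e e0.
    have gD : p x + g n x <= D x.
      rewrite -lerBrDl ge_min; apply/orP; left.
      by rewrite /f max_l // subr_ge0 pD.
    have /cvgr_gt /(_ (D x - e)) : diff_quotient V x h @[h --> 0^'+] --> D x by exact: dV.
    rewrite ltrBlDr ltrDl => /(_ e0) H; near=> h.
    have h0 : 0 < h by [].
    have : D x - e < diff_quotient V x h by near: h.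
    rewrite /diff_quotient mulrC ltr_pdivlMr // => Hh.
    have := ler_wpM2r (ltW h0) gD.
    lra.
have -> : (\int[mu]_(x in `[a, b]) (f x)%:E)%E = limn (fun n => \int[mu]_(x in `[a, b]) (g n x)%:E)%E.
  apply/esym/cvg_lim => //.
  have -> : (\int[mu]_(x in `[a, b]) (f x)%:E)%E = (\int[mu]_(x in `[a, b]) limn (fun n => (g n x)%:E))%E.
    apply: eq_integral => x _; apply/esym/cvg_lim => //.
    apply: cvg_near_cst; near=> n; rewrite /g /= min_l //.
    by near: n; exact: nbhs_infty_ger.
  apply: cvg_monotone_convergence => //.
  - by move=> n; apply/measurable_EFinP; exact: mg.
  - by move=> n x _; rewrite lee_fin.
  - by move=> x _ m n mn; rewrite lee_fin le_min ge_min lexx /= ge_min ler_nat mn orbT.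
apply: lime_le; last by apply: nearW => n; exact: key.
apply: ereal_nondecreasing_is_cvgn => m n mn; apply: ge0_le_integral => //.
- by move=> x _; rewrite lee_fin.
- by apply/measurable_EFinP; exact: mg.
- by apply/measurable_EFinP; exact: mg.
- by move=> x _; rewrite lee_fin le_min ge_min lexx /= ge_min ler_nat mn orbT.
Unshelve. all: by end_near.
Qed.

(** The function [p + max (D - p) 0] dominates [D], and it is integrable as soon as the right-hand
    side is finite; an infinite right-hand side leaves nothing to show. *)
Lemma increment_le_excess (R : realType) (a b : R) (V D p : R -> R) :
  a <= b -> {within `[a, b], continuous V} -> measurable_fun `[a, b] D ->
  (@lebesgue_measure R).-integrable `[a, b] (EFin \o p) ->
  (forall x, a < x < b -> diff_quotient V x h @[h --> 0^'+] --> D x) ->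
  ((V b - V a - \int[@lebesgue_measure R]_(x in `[a, b]) p x)%:E <=
   \int[@lebesgue_measure R]_(x in `[a, b]) (Num.max (D x - p x) 0)%:E)%E.
Proof.
move=> ab cV mD ip dV.
pose mu := @lebesgue_measure R.
have mab : measurable (`[a, b]%classic : set (measurableTypeR R)) by [].
have mp : measurable_fun `[a, b] p by apply/measurable_EFinP; exact: measurable_int ip.
pose f x : R := Num.max (D x - p x) 0.
have f0 x : 0 <= f x by rewrite le_max lexx orbT.
have mf : measurable_fun `[a, b] f.
  by apply: measurable_maxr; [exact: measurable_funB|exact: measurable_cst].
have [foo|foo] := ltP (\int[mu]_(x in `[a, b]) (f x)%:E)%E +oo%E; last first.
  by apply: le_trans foo; exact: leey.
have if_ : mu.-integrable `[a, b] (EFin \o f).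
  apply/integrableP; split; first exact/measurable_EFinP.
  apply: le_lt_trans foo; rewrite le_eqVlt; apply/orP; left; apply/eqP.
  by apply: eq_integral => x _; rewrite /= ger0_norm.
have ipf : mu.-integrable `[a, b] (EFin \o (fun x => p x + f x)).
  by have := integrableD mab ip if_; apply: eq_integrable.
have -> : (\int[mu]_(x in `[a, b]) (f x)%:E)%E = (\int[mu]_(x in `[a, b]) f x)%:E.
  by rewrite /Rintegral fineK //; exact: integrable_fin_num if_.
rewrite lee_fin lerBlDl -RintegralD //.
apply: increment_le_integral => // x xab e e0.
have Df : D x <= p x + f x by rewrite -lerBlDl le_max lexx.
have /cvgr_lt /(_ (D x + e)) : diff_quotient V x h @[h --> 0^'+] --> D x by exact: dV.
rewrite ltrDl => /(_ e0) H; near=> h.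
have h0 : 0 < h by [].
have : diff_quotient V x h < D x + e by near: h.
rewrite /diff_quotient mulrC ltr_pdivrMr // => /ltW Hh.
by apply: (le_trans Hh); rewrite ler_wpM2r ?(ltW h0) // lerD2r.
Unshelve. all: by end_near.
Qed.

(** * One-sided derivatives on the half-line *)

Lemma hderivable_right (R : realType) (f : R -> R) (x : R) :
  0 <= x -> hderivable f x -> diff_quotient f x h @[h --> 0^'+] --> hderive f x.
Proof.
move=> x0 df; apply: cvg_trans df.
move=> A HA.
have {}HA : \forall h \near (0 : R), h != 0 -> 0 <= x + h -> A (diff_quotient f x h).
  exact: HA.
suff : \forall h \near (0 : R), 0 < h -> A (diff_quotient f x h) by [].
apply: filterS HA => h Ah h0; apply: Ah; first by rewrite gt_eqF.
by rewrite addr_ge0 // ltW.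
Qed.

Lemma hderivable_within_continuous (R : realType) (f : R -> R) :
  (forall x : R, 0 <= x -> hderivable f x) -> {within `[0, +oo[, continuous f}.
Proof.
move=> df; apply/subspace_continuousP => x /=; rewrite in_itv /= andbT => x0.
have dfx := df x x0.
(* [K] bounds the difference quotients near [x], so an increment below [e / K] moves [f] by less
   than [e]. *)
pose K := `|hderive f x| + 1.
have K0 : 0 < K by rewrite ltr_wpDl.
have : \forall h \near within [set h | 0 <= x + h] 0^', `|diff_quotient f x h| < K.
  have /cvgr_dist_lt /(_ 1 ltr01) := dfx; apply: filterS => h H.
  rewrite -ltrBlDl (le_lt_trans _ H) // distrC (le_trans _ (ler_dist_dist _ _)) //.
  exact: ler_norm.
move=> /nbhs_ballP[d /= d0 Hd].
apply/cvgrPdist_lt => e e0; apply/nbhs_ballP; exists (Num.min d (e / K)) => /=.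
  by rewrite lt_min d0 divr_gt0.
move=> y; rewrite /ball /= lt_min => /andP[yd ye]; rewrite in_itv /= andbT => y0.
have [->|yx] := eqVneq y x; first by rewrite subrr normr0.
have yx0 : y - x != 0 by rewrite subr_eq0.
have := Hd (y - x); rewrite /ball /= sub0r normrN distrC => /(_ yd yx0).
rewrite subrKC => /(_ y0); rewrite /diff_quotient subrKC normrM normfV.
rewrite mulrC ltr_pdivrMr ?normr_gt0 // => H.
by rewrite distrC (lt_trans H) // mulrC -ltr_pdivlMr // distrC.
Qed.

(** The derivative is the pointwise limit of quotients with increments [1 / (n + 1)], which never
    leave the half-line. *)
Lemma measurable_hderive (R : realType) (f : R -> R) :
  (forall x : R, 0 <= x -> hderivable f x) -> measurable_fun (`[0, +oo[ : set R) (hderive f).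
Proof.
move=> df.
have mf : measurable_fun (`[0, +oo[ : set R) f.
  by apply: subspace_continuous_measurable_fun => //; exact: hderivable_within_continuous.
apply: (@measurable_fun_cvg _ _ _ _ (fun n x => diff_quotient f x (n.+1%:R^-1))).
- move=> n; rewrite /diff_quotient; apply: measurable_funM; first exact: measurable_cst.
  apply: measurable_funB => //.
  apply: (@measurable_comp _ _ _ _ _ _ (`[0, +oo[ : set R) f) => //.
    by move=> _ [y /= + <-]; rewrite !in_itv /= !andbT => y0; rewrite addr_ge0.
  by apply: measurable_funD; [exact: measurable_id|exact: measurable_cst].
- move=> x /=; rewrite in_itv /= andbT => x0.
  have /cvg_at_rightP := hderivable_right _ _ _ x0 (df _ x0).
  apply; split; first by move=> n; rewrite invr_gt0.
  exact: cvg_harmonic.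
Qed.

Lemma hderive_ge0 (R : realType) (f : R -> R) (x : R) :
  0 <= x -> hderivable f x -> (forall y z : R, 0 <= y -> y <= z -> f y <= f z) ->
  0 <= hderive f x.
Proof.
move=> x0 df fle; have dfx := hderivable_right _ _ _ x0 df.
rewrite -(cvg_lim _ dfx) //; apply: limr_ge; first by apply/cvg_ex; eexists; exact: dfx.
near=> h; have h0 : 0 < h by [].
by rewrite /diff_quotient mulr_ge0 ?invr_ge0 ?(ltW h0) // subr_ge0 fle // lerDl ltW.
Unshelve. all: by end_near.
Qed.

(** The case [p = 0] of [excess_le_increment]. It makes the worst type's marginal cost an integrable
    price schedule whose total is covered by the cost increment. *)
Lemma ge0_hderive_integrable (R : realType) (f : R -> R) (b : R) :
  0 <= b -> (forall x : R, 0 <= x -> hderivable f x) ->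
  (forall x : R, 0 <= x -> 0 <= hderive f x) ->
  (@lebesgue_measure R).-integrable `[0, b] (EFin \o hderive f) /\
  \int[@lebesgue_measure R]_(x in `[0, b]) hderive f x <= f b - f 0.
Proof.
move=> b0 df f0.
have sub : `[0, b]%classic `<=` (`[0, +oo[%classic : set R).
  by move=> x /=; rewrite !in_itv /= andbT => /andP[].
have mD : measurable_fun `[0, b] (hderive f).
  exact: measurable_funS (measurable_hderive _ _ df).
have cf : {within `[0, b], continuous f}.
  exact: continuous_subspaceW sub (hderivable_within_continuous _ _ df).
have i0 : (@lebesgue_measure R).-integrable `[0, b] (EFin \o cst (0 : R)).
  by apply: (@bounded_integrable_itv _ _ _ 0) => // x _; rewrite normr0.
have := @excess_le_increment R 0 b f (hderive f) (cst 0) b0 cf mD i0.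
rewrite [\int[_]_(_ in _) cst 0 _](_ : _ = 0); last by rewrite Rintegral_cst // mul0r.
rewrite subr0 => H.
have {H} : (\int[@lebesgue_measure R]_(x in `[0%R, b]) (hderive f x)%:E <= (f b - f 0)%:E)%E.
  rewrite (_ : (\int[_]_(x in _) _)%E =
    (\int[@lebesgue_measure R]_(x in `[0%R, b]) (Num.max (hderive f x - cst 0 x) 0)%:E)%E).
    by apply: H => x /andP[/ltW x0 _]; [exact: hderivable_right (df _ x0)|exact: f0].
  apply: eq_integral => x; rewrite inE /= in_itv /= subr0 => /andP[x0 _].
  by rewrite max_l // f0.
move=> H; have ih : (@lebesgue_measure R).-integrable `[0, b] (EFin \o hderive f).
  apply/integrableP; split; first exact/measurable_EFinP.
  apply: le_lt_trans (ltry (f b - f 0)); apply: le_trans H.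
  rewrite le_eqVlt; apply/orP; left; apply/eqP; apply: eq_integral => x.
  by rewrite inE /= in_itv /= => /andP[x0 _]; rewrite ger0_norm // f0.
split=> //; rewrite -lee_fin /Rintegral fineK //; exact: integrable_fin_num ih.
Qed.

(** The difference [f - g] has right derivative at most 0, so the zero function bounds its slopes.
    This turns the ordering of marginal costs across types into an ordering of cost increments. *)
Lemma hderive_le_increment (R : realType) (f g : R -> R) (a b : R) :
  0 <= a -> a <= b ->
  (forall x : R, 0 <= x -> hderivable f x) -> (forall x : R, 0 <= x -> hderivable g x) ->
  (forall x : R, 0 <= x -> hderive f x <= hderive g x) ->
  f b - f a <= g b - g a.
Proof.
move=> a0 ab df dg fg.
have sub : `[a, b]%classic `<=` (`[0, +oo[%classic : set R).
  by move=> x /=; rewrite !in_itv /= andbT => /andP[ax _]; exact: le_trans ax.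
have cfg : {within `[a, b], continuous (fun x => f x - g x)}.
  apply: (continuous_subspaceW sub) => x; apply: continuousB.
  - exact: hderivable_within_continuous df x.
  - exact: hderivable_within_continuous dg x.
have i0 : (@lebesgue_measure R).-integrable `[a, b] (EFin \o cst (0 : R)).
  by apply: (@bounded_integrable_itv _ _ _ 0) => // x _; rewrite normr0.
have := @increment_le_integral R a b (fun x => f x - g x) (cst 0) ab cfg i0.
rewrite [\int[_]_(_ in _) cst 0 _](_ : _ = 0); last by rewrite Rintegral_cst // mul0r.
move=> H; have {H} : f b - g b - (f a - g a) <= 0; last by lra.
apply: H => x /andP[ax xb] e e0.
have x0 : 0 <= x by rewrite (le_trans a0) // ltW.
have e20 : 0 < e / 2 by rewrite divr_gt0.
have /cvgr_lt /(_ (hderive f x + e / 2)) := hderivable_right _ _ _ x0 (df x x0).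
rewrite ltrDl => /(_ e20) Hf.
have /cvgr_gt /(_ (hderive g x - e / 2)) := hderivable_right _ _ _ x0 (dg x x0).
rewrite ltrBlDr ltrDl => /(_ e20) Hg.
near=> h.
have h0 : 0 < h by [].
have : diff_quotient f x h < hderive f x + e / 2 by near: h.
have : hderive g x - e / 2 < diff_quotient g x h by near: h.
rewrite /diff_quotient [h^-1 * _]mulrC ltr_pdivlMr // => Hgh.
rewrite [h^-1 * _]mulrC ltr_pdivrMr // => Hfh.
have := ler_wpM2r (ltW h0) (fg x x0).
rewrite /= add0r; lra.
Unshelve. all: by end_near.
Qed.

(** * Expectations that may be infinite *)

Lemma ae_le_integral d (T : measurableType d) (R : realType)
    (mu : {measure set T -> \bar R}) (D : set T) (f g : T -> \bar R) :
  measurable D -> measurable_fun D f -> measurable_fun D g ->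
  {ae mu, forall x, D x -> (f x <= g x)%E} ->
  (\int[mu]_(x in D) f x <= \int[mu]_(x in D) g x)%E.
Proof.
move=> mD mf mg fg; rewrite integralE [leRHS]integralE; apply: leeB.
- apply: ae_ge0_le_integral => //; [exact: measurable_funepos..|].
  apply: filterS fg => x /= fg Dx; rewrite !funeposE.
  by rewrite ge_max !le_max lexx orbT andbT fg.
- apply: ae_ge0_le_integral => //; [exact: measurable_funeneg..|].
  apply: filterS fg => x /= fg Dx; rewrite !funenegE.
  by rewrite ge_max !le_max lexx orbT andbT leeN2 fg.
Qed.

(** An infinite integral of [A] makes the bound trivial; a finite one makes [A] integrable, so that
    the constant comes out. *)
Lemma integral_le_shift d (T : measurableType d) (R : realType)
    (P : probability T R) (X : T -> R) (A : T -> \bar R) (K : R) :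
  measurable_fun setT X -> measurable_fun setT A -> (forall x, 0 <= A x)%E ->
  (forall x, (X x)%:E <= A x - K%:E)%E ->
  (\int[P]_x (X x)%:E <= \int[P]_x A x - K%:E)%E.
Proof.
move=> mX mA A0 XA.
have [Aoo|] := ltP (\int[P]_x A x)%E +oo%E; last first.
  by rewrite leye_eq => /eqP ->; rewrite addye ?leey.
have iA : P.-integrable setT A.
  apply/integrableP; split => //.
  by under eq_integral do rewrite gee0_abs //.
have iK : P.-integrable setT (EFin \o cst K) by exact: finite_measure_integrable_cst.
have iKE : (\int[P]_x (K%:E) = K%:E)%E.
  by rewrite integral_cst //= probability_setT mule1.
have -> : (\int[P]_x A x - K%:E = \int[P]_x (A x - (EFin \o cst K) x))%E.
  by rewrite integralB //= iKE.
apply: ae_le_integral => //.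
- exact/measurable_EFinP.
- by apply: emeasurable_funB => //; exact/measurable_EFinP.
- by apply: aeW => x _; exact: XA.
Qed.

(** The delicate case is an infinite integral of [A]. Almost surely [X >= - K] and [A <= X^+ + |K|],
    so the negative part of [X] has a finite integral, its positive part an infinite one, and the
    mean of [X] is infinite too. *)
Lemma integral_ge_shift d (T : measurableType d) (R : realType)
    (P : probability T R) (X : T -> R) (A : T -> \bar R) (K : R) :
  measurable_fun setT X -> measurable_fun setT A -> (forall x, 0 <= A x)%E ->
  {ae P, forall x, (A x - K%:E <= (X x)%:E)%E} ->
  (\int[P]_x A x - K%:E <= \int[P]_x (X x)%:E)%E.
Proof.
move=> mX mA A0 XA.
have iK (k : R) : P.-integrable setT (EFin \o cst k) by exact: finite_measure_integrable_cst.
have mEX : measurable_fun setT (EFin \o X) by exact/measurable_EFinP.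
have iKE (k : R) : (\int[P]_x (k%:E) = k%:E)%E.
  by rewrite integral_cst //= probability_setT mule1.
have [Aoo|Aoo] := ltP (\int[P]_x A x)%E +oo%E.
  have iA : P.-integrable setT A.
    apply/integrableP; split => //.
    by under eq_integral do rewrite gee0_abs //.
  have -> : (\int[P]_x A x - K%:E = \int[P]_x (A x - (EFin \o cst K) x))%E.
    by rewrite integralB //= iKE.
  apply: ae_le_integral => //.
  - by apply: emeasurable_funB => //; exact/measurable_EFinP.
  - by apply: filterS XA => x XA _; exact: XA.
have neg : (\int[P]_x (EFin \o X)^\- x <= `|K|%:E)%E.
  rewrite -iKE; apply: ae_ge0_le_integral => //.
  - exact: measurable_funeneg.
  - apply: filterS XA => x XA _; rewrite funenegE /= ge_max.
    apply/andP; split; last by rewrite lee_fin.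
    rewrite lee_fin lerNl; have := le_trans (leeB (A0 x) (lexx K%:E)) XA.
    by rewrite sub0e -EFinN lee_fin; apply: le_trans; rewrite lerN2 ler_norm.
have pos : (\int[P]_x (EFin \o X)^\+ x = +oo)%E.
  apply/eqP; rewrite -leye_eq leNgt; apply/negP => Xoo; move: Aoo; rewrite leNgt => /negP; apply.
  apply: (@le_lt_trans _ _ (\int[P]_x ((EFin \o X)^\+ x + `|K|%:E)%E)%E).
    apply: ae_ge0_le_integral => //.
    - by move=> x _; rewrite adde_ge0 // lee_fin.
    - by apply: emeasurable_funD => //; exact: measurable_funepos.
    - apply: filterS XA => x XA _; rewrite leeBlDr // in XA.
      by apply: (le_trans XA); apply: leeD; rewrite ?lee_fin ?ler_norm // funeposE le_max lexx.
  rewrite ge0_integralD //; [|exact: measurable_funepos].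
  by rewrite iKE lte_add_pinfty // ltry.
rewrite [leRHS]integralE pos addye ?leey // (_ : -oo = - +oo)%E // eqe_opp.
by rewrite lt_eqF // (le_lt_trans neg) // ltry.
Qed.

(** Tonelli's theorem on the region [l <= Y w]. The outer integral leaves out the null point 0
    because prices and acceptance are compared only at [l > 0]. *)
Lemma expectation_integral_upto d (T : measurableType d) (R : realType)
    (P : probability T R) (Y : T -> R) (phi : R -> R) :
  measurable_fun setT Y -> measurable_fun (`[0, +oo[ : set R) phi ->
  (forall l : R, 0 <= phi l) ->
  let A w := (\int[@lebesgue_measure R]_(l in `[0%R, Y w]) (phi l)%:E)%E in
  let B (l : R) := ((phi l)%:E * P [set w | (l <= Y w)%R])%E in
  [/\ measurable_fun setT A, measurable_fun (`]0, +oo[ : set R) B &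
      (\int[P]_w A w = \int[@lebesgue_measure R]_(l in `]0%R, +oo[) B l)%E].
Proof.
move=> mY mphi phi0 A B.
pose mu := @lebesgue_measure R.
(* Extension by 0 gives a function measurable on the whole line, as the product space requires. *)
pose psi := phi \_ `]0, +oo[.
have sub0 : `]0, +oo[%classic `<=` (`[0, +oo[%classic : set R).
  by apply: subset_itvr; rewrite bnd_simp.
have psi0 l : 0 <= psi l by rewrite /psi patchE; case: ifP.
have mpsi : measurable_fun setT psi.
  by apply/(measurable_restrictT _ _).1 => //; exact: measurable_funS mphi.
pose S := [set z : T * R | z.2 <= Y z.1].
have mS : measurable S.
  rewrite (_ : S = setT `&` (fun z : T * R => Y z.1 - z.2) @^-1` `[0, +oo[).
    suff mYl : measurable_fun setT (fun z : T * R => Y z.1 - z.2) by exact: mYl.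
    apply: measurable_funB; last exact: measurable_snd.
    exact: measurableT_comp mY measurable_fst.
  by rewrite setTI; apply/seteqP; split => z /=; rewrite /S /= in_itv /= andbT subr_ge0.
pose f (z : T * R) : \bar R := ((psi z.2)%:E * (\1_S z)%:E)%E.
have f0 z : (0 <= f z)%E by rewrite mule_ge0 ?lee_fin.
have mf : measurable_fun setT f.
  apply: emeasurable_funM; apply/measurable_EFinP.
    exact: measurableT_comp mpsi measurable_snd.
  exact: measurable_indic.
have AE w : A w = (\int[mu]_l f (w, l))%E.
  rewrite /A -integral_itv_obnd_cbnd; last first.
    apply/measurable_EFinP; apply: measurable_funS mphi => //.
    by move=> x /=; rewrite !in_itv /= andbT => /andP[/ltW].
  rewrite integral_mkcond; apply: eq_integral => l _.
  rewrite /f /psi !patchE /= indicE.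
  have -> : (l \in `]0, Y w]%classic) = (l \in `]0, +oo[%classic) && ((w, l) \in S).
    apply/idP/andP => [|[]]; rewrite !inE /S /= !in_itv /= andbT.
      by move=> /andP[-> ->].
    by move=> -> ->.
  by case: (l \in _); case: (_ \in S); rewrite /= ?mul0e ?mule0 ?mule1.
have BE l : (\int[P]_w f (w, l) = (psi l)%:E * P [set w | (l <= Y w)%R])%E.
  have mYl : measurable [set w | (l <= Y w)%R].
    rewrite (_ : [set _ | _] = setT `&` Y @^-1` `[l, +oo[); first exact: mY.
    by rewrite setTI; apply/seteqP; split => w /=; rewrite in_itv /= andbT.
  rewrite (eq_integral (fun w => (psi l)%:E * (\1_[set w | (l <= Y w)%R] w)%:E)%E).
    rewrite ge0_integralZl ?integral_indic ?setIT ?lee_fin //.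
    exact/measurable_EFinP/measurable_indic.
  move=> w _; rewrite /f !indicE /=.
  suff -> : ((w, l) \in S) = (w \in [set w | l <= Y w]) by [].
  by apply/idP/idP; rewrite !inE.
split.
- rewrite (_ : A = fubini_F mu f); last by apply/funext => w; rewrite AE.
  exact: measurable_fun_fubini_tonelli_F.
- have := measurable_fun_fubini_tonelli_G (m1 := P) f mf f0.
  move=> mG.
  have {mG} : measurable_fun (`]0, +oo[ : set R) (fubini_G P f) by exact: measurable_funTS.
  apply: eq_measurable_fun => l l0; rewrite /fubini_G BE /B /psi patchE.
  by rewrite l0.
- rewrite (eq_integral (fun w => \int[mu]_l f (w, l))%E); last by move=> w _; rewrite AE.
  transitivity (\int[mu]_l \int[P]_w f (w, l))%E; first exact: fubini_tonelli.
  rewrite [RHS]integral_mkcond; apply: eq_integral => l _.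
  by rewrite BE /psi /B !patchE; case: ifP => // _; rewrite mul0e.
Qed.

(** * Measurability on the half-line *)

Lemma measurable_fun_halfline (R : realType) (p : R -> R) :
  (forall b : R, 0 <= b -> measurable_fun `[0, b] p) ->
  measurable_fun (`[0, +oo[ : set R) p.
Proof.
move=> mp; rewrite (_ : `[0, +oo[%classic = \bigcup_n `[0 : R, n%:R]%classic).
  by apply/measurable_fun_bigcup => // n; exact: mp.
apply/seteqP; split => [x /=|x [n _] /=]; rewrite !in_itv /= andbT; last by case/andP.
move=> x0; exists (Num.trunc x).+1 => //=; rewrite in_itv /= x0 /=.
by apply/ltW; case/andP: (truncn_itv x0).
Qed.

Lemma measurable_fun_superlevel d (T : measurableType d) (R : realType) (Y : T -> R) :
  (forall l : R, measurable [set w | l <= Y w]) -> measurable_fun setT Y.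
Proof.
move=> mY _; apply: (measurability _ (RGenCInfty.measurableE R)) => //.
move=> _ [_ [l ->] <-]; rewrite setTI (_ : _ @^-1` _ = [set w | l <= Y w]) //.
by apply/seteqP; split => w /=; rewrite in_itv /= andbT.
Qed.

Lemma measurable_comp_halfline d (T : measurableType d) (R : realType)
    (f : R -> R) (Y : T -> R) :
  {within `[0, +oo[, continuous f} -> measurable_fun setT Y -> (forall w, 0 <= Y w) ->
  measurable_fun setT (fun w => f (Y w)).
Proof.
move=> cf mY Y0; apply: (@measurable_comp _ _ _ _ _ _ (`[0, +oo[ : set R) f) => //.
  by move=> _ [w _ <-] /=; rewrite in_itv /= andbT.
exact: subspace_continuous_measurable_fun.
Qed.

(** * Costs, regular payments and feasible mechanisms *)

Section Procurement.
Context {R : realType} {d d' : measure_display} {Omega : measurableType d}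
  {Wth : measurableType d'} {P : probability Omega R} {n m : nat}
  {E : environment Wth P n} (hE : standing_assumptions E m).

Let mu := @lebesgue_measure R.

Lemma expected_cost_nondecreasing x (q1 q2 : R) :
  types E x -> 0 <= q1 -> q1 <= q2 -> expected_cost E q1 x <= expected_cost E q2 x.
Proof.
move=> tx q10 q12; apply: le_Rintegral => //.
- exact: cost_integrable hE _ _ q10 tx.
- by apply: cost_integrable hE _ _ _ tx; exact: le_trans q12.
- by move=> w _; apply: cost_incr hE _ _ _ _ tx q10 q12.
Qed.

Lemma marginal_cost_ge0 x (q : R) : types E x -> 0 <= q -> 0 <= marginal_cost E q x.
Proof.
move=> tx q0; apply: hderive_ge0 => //; first exact: expected_cost_diff hE _ _ q0 tx.
by move=> y z; exact: expected_cost_nondecreasing.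
Qed.

(** At quantity 0 the cost is the first coordinate of the type, which lies among the first [m],
    where the worst type is maximal. *)
Lemma expected_cost0_le_worst x :
  types E x -> expected_cost E 0 x <= expected_cost E 0 (worst E).
Proof.
move=> tx; have /andP[m1 mn] := m_range hE.
pose i := Ordinal (leq_trans (ltnW m1) mn).
have c0 y : types E y -> expected_cost E 0 y = tnth y i.
  move=> ty; rewrite /expected_cost.
  transitivity (\int[distribution P (weather E)]_w cst (tnth y i) w).
    by apply: eq_Rintegral => w _; exact: cost0 hE _ _ i ty erefl.
  by rewrite Rintegral_cst //= probability_setT mulr1.
rewrite !c0 //; last exact: worst_in hE.
by have := worst_ge hE tx i; rewrite /= (ltnW m1).
Qed.

Lemma best_quantity_menu (T : R -> R) (q : n.-tuple R -> {nonneg R}) :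
  (forall x, types E x -> best_quantity E T x (q x)%:num) ->
  equilibrium E (M := menu T) q.
Proof. by move=> hq x tx msg; have [_] := hq x tx; exact. Qed.

(** Regularity speaks of the seller's net payoff; adding back the cost of the worst type, continuous
    because differentiable, recovers [T]. *)
Lemma regular_payment_continuous (T p : R -> R) :
  regular_payment E T p -> {within `[0, +oo[, continuous T}.
Proof.
move=> hreg; have tw := worst_in hE.
have cEC : {within `[0, +oo[, continuous (expected_cost E ^~ (worst E))}.
  by apply: hderivable_within_continuous => x x0; exact: expected_cost_diff hE _ _ x0 tw.
have := seller_continuous hreg tw => cT.
rewrite (_ : T = (fun l => T l - expected_cost E l (worst E) + expected_cost E l (worst E))).
  by move=> x; exact: (continuousD (cT x) (cEC x)).
by apply/funext => l; rewrite subrK.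
Qed.

Lemma regular_payment_measurable_price (T p : R -> R) :
  regular_payment E T p -> measurable_fun (`[0, +oo[ : set R) p.
Proof.
move=> hreg; apply: measurable_fun_halfline => b b0; apply/measurable_EFinP.
by have /integrableP[] := price_integrable hreg b0.
Qed.

(* Below the quantity of the worst type every type accepts the worst type's
   marginal cost, and the participation of the worst type bounds the payment
   from below by the cost this price schedule integrates to. *)
Lemma feasible_price_schedule (M : mechanism R) (s : n.-tuple R -> message M) :
  feasible E s -> exists p' : R -> R,
  [/\ forall b : R, 0 <= b -> mu.-integrable `[0, b] (EFin \o p'),
      forall x, types E x -> \int[mu]_(l in `[0, (quantity (s x))%:num]) p' l
        + expected_cost E 0 (worst E) <= payment (s x) &
      forall x l, types E x -> 0 < l -> l <= (quantity (s x))%:num ->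
        marginal_cost E l x <= p' l].
Proof.
move=> [_ _ VP [T [p [hreg hT]]]].
have tw := worst_in hE.
pose qw : R := (quantity (s (worst E)))%:num.
have qw0 : 0 <= qw by rewrite /qw ge0.
pose c l := marginal_cost E l (worst E).
have dEC x : types E x -> forall l : R, 0 <= l -> hderivable (expected_cost E ^~ x) l.
  by move=> tx l l0; exact: expected_cost_diff hE _ _ l0 tx.
have ic (b : R) : 0 <= b -> mu.-integrable `[0, b] (EFin \o c) /\
    \int[mu]_(l in `[0, b]) c l <= expected_cost E b (worst E) - expected_cost E 0 (worst E).
  move=> b0; apply: ge0_hderive_integrable b0 (dEC _ tw) _ => l l0.
  exact: marginal_cost_ge0.
pose p' l := if l <= qw then c l else p l.
have mp' : measurable_fun (`[0, +oo[ : set R) p'.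
  apply: measurable_fun_if => //.
  - by apply: measurable_fun_ler; [exact: measurable_id|exact: measurable_cst].
  - have mc : measurable_fun (`[0, +oo[ : set R) c.
      by apply: measurable_hderive; exact: dEC.
    by apply: measurable_funS mc => //; exact: subIsetl.
  - apply: measurable_funS (regular_payment_measurable_price _ _ hreg) => //.
have ip' (b : R) : 0 <= b -> mu.-integrable `[0, b] (EFin \o p').
  move=> b0.
  have := integrableD _ (integrable_abse (ic b b0).1) (integrable_abse (price_integrable hreg b0)).
  move=> /(_ (measurable_itv _)).
  apply: le_integrable => //.
    apply/measurable_EFinP; apply: measurable_funS mp' => //.
    by move=> x /=; rewrite !in_itv /= andbT => /andP[].
  move=> x _ /=; rewrite lee_fin /p' [leRHS]ger0_norm ?addr_ge0 //.
  by case: ifP => _; rewrite ?lerDl ?lerDr.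
exists p'; split => //.
- move=> x tx; set q := (quantity (s x))%:num.
  have q0 : 0 <= q by rewrite /q ge0.
  have [[_ bq] ->] := hT x tx.
  have [[_ bw] payw] := hT _ tw.
  have VPw : expected_cost E qw (worst E) <= T qw.
    by have := VP _ tw; rewrite /seller_utility payw subr_ge0.
  have [qqw|qwq] := leP q qw.
  (* Since [x] does not prefer [qw], its payment is at least [T qw] less its own cost increment from
     [q] to [qw], hence less that of the worst type. Participation of the worst type then leaves at
     least that type's cost at [q]. *)
  + have -> : \int[mu]_(l in `[0, q]) p' l = \int[mu]_(l in `[0, q]) c l.
      apply: eq_Rintegral => l; rewrite inE /= in_itv /= => /andP[_ lq].
      by rewrite /p' (le_trans lq qqw).
    have := (ic q q0).2.
    have := bq qw qw0.
    have : expected_cost E qw x - expected_cost E q x <=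
           expected_cost E qw (worst E) - expected_cost E q (worst E).
      apply: (hderive_le_increment _ (expected_cost E ^~ x) (expected_cost E ^~ (worst E)))
        => //; [exact: dEC|exact: dEC|move=> l l0].
      exact: marginal_cost_mono hE _ _ _ l0 tx tw (worst_ge hE tx).
    rewrite -/q; lra.
  (* Participation of the worst type pays for the units up to [qw]; beyond [qw] the payment grows
     exactly at the price [p]. *)
  + have Tq := payment_price hreg q0.
    have Tqw := payment_price hreg qw0.
    have bd (f : R -> R) : (forall b : R, 0 <= b -> mu.-integrable `[0, b] (EFin \o f)) ->
        \int[mu]_(l in `[0, q]) f l = \int[mu]_(l in `[0, qw]) f l + \int[mu]_(l in `]qw, q]) f l.
      move=> if_; rewrite -(@Rintegral_itvB R f (BLeft 0) (BRight q) qw) ?bnd_simp //.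
      + by rewrite subrKC.
      + exact: if_.
      + exact: ltW.
    have E1 : \int[mu]_(l in `[0, qw]) p' l = \int[mu]_(l in `[0, qw]) c l.
      apply: eq_Rintegral => l; rewrite inE /= in_itv /= => /andP[_ lq].
      by rewrite /p' lq.
    have E2 : \int[mu]_(l in `]qw, q]) p' l = \int[mu]_(l in `]qw, q]) p l.
      apply: eq_Rintegral => l; rewrite inE /= in_itv /= => /andP[ql _].
      by rewrite /p' leNgt ql.
    have := (ic qw qw0).2.
    move: Tq; rewrite -/q (bd p' ip') E1 E2 (bd p (price_integrable hreg)).
    move: Tqw VPw.
    lra.
- move=> x l tx l0 lq; rewrite /p'; case: ifP => _.
    by apply: marginal_cost_mono hE _ _ _ (ltW l0) tx tw (worst_ge hE tx).
  (* Beyond [qw] the delivered quantity itself witnesses willingness to produce [l]. *)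
  apply/(seller_first_order hreg tx l0).
  by exists (quantity (s x))%:num => //; have [] := hT x tx.
Qed.

(** * Bounds on the buyer's payoff by the excess of marginal value over price *)

(** For each type, [increment_le_excess] bounds value minus payment, and Tonelli turns the mean into
    an integral over [l]. Survival is at most acceptance because whoever delivers at least [l]
    accepts [p' l]. *)
Lemma buyer_payoff_le (M : mechanism R) (s : n.-tuple R -> message M) :
  feasible E s -> exists p' : R -> R,
  [/\ forall b : R, 0 <= b -> mu.-integrable `[0, b] (EFin \o p'),
      forall l : R, 0 < l -> (P [set w | (l <= (quantity (s (rtype E w)))%:num)%R]
        <= (acceptance E l (p' l))%:E)%E,
      measurable_fun (`]0, +oo[ : set R) (fun l => ((Num.max (hderive (value E) l - p' l) 0)%:E
            * P [set w | (l <= (quantity (s (rtype E w)))%:num)%R])%E) &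
      (buyer_payoff E s <=
        \int[mu]_(l in `]0%R, +oo[) ((Num.max (hderive (value E) l - p' l) 0)%:E
            * P [set w | (l <= (quantity (s (rtype E w)))%:num)%R])
        - (expected_cost E 0 (worst E))%:E)%E].
Proof.
move=> fs; have [p' [ip' payp' cp']] := feasible_price_schedule _ _ fs.
have [[mq mpay] _ _ _] := fs.
have dV := value_diff hE.
pose Y w : R := (quantity (s (rtype E w)))%:num.
have Y0 w : 0 <= Y w by rewrite /Y ge0.
have mp' : measurable_fun (`[0, +oo[ : set R) p'.
  by apply: measurable_fun_halfline => b b0; apply/measurable_EFinP; have /integrableP[] := ip' b b0.
have mD := measurable_hderive _ _ dV.
have cV := hderivable_within_continuous _ _ dV.
pose phi l : R := Num.max (hderive (value E) l - p' l) 0.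
have mphi : measurable_fun (`[0, +oo[ : set R) phi.
  by apply: measurable_maxr; [exact: measurable_funB|exact: measurable_cst].
have phi0 l : 0 <= phi l by rewrite le_max lexx orbT.
have [mA mB AB] := expectation_integral_upto _ _ _ P Y phi mq mphi phi0.
have mY (l : R) : measurable [set w | l <= Y w].
  rewrite (_ : [set _ | _] = setT `&` Y @^-1` `[l, +oo[); first exact: mq.
  by rewrite setTI; apply/seteqP; split => w /=; rewrite in_itv /= andbT.
exists p'; split => //.
- move=> l l0; rewrite /acceptance fineK; last first.
    by apply: fin_num_measure; exact: acceptance_measurable hE _ _ (ltW l0).
  apply: measure_subset; [exact: mY|exact: acceptance_measurable hE _ _ (ltW l0)|].
  by move=> w /= lY; apply: cp' => //; exact: rtype_in hE w.
- rewrite -AB /buyer_payoff unlock; apply: integral_le_shift => //.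
  + by apply: measurable_funB => //; exact: measurable_comp_halfline.
  + by move=> w; apply: integral_ge0 => l _; rewrite lee_fin.
  + move=> w; have := payp' _ (rtype_in hE w); rewrite -/(Y w) => pay.
    have sub : `[0, Y w]%classic `<=` (`[0, +oo[%classic : set R).
      by move=> x /=; rewrite !in_itv /= andbT => /andP[].
    have := @increment_le_excess R 0 (Y w) (value E) (hderive (value E)) p' (Y0 w)
      (continuous_subspaceW sub cV) (measurable_funS (measurable_itv _) sub mD) (ip' _ (Y0 w)).
    rewrite (value0 hE) subr0 => H.
    have {}H := H (fun x xY => hderivable_right _ _ _ (ltW (andP xY).1) (dV x (ltW (andP xY).1))).
    rewrite leeBrDr // -EFinD; apply: le_trans H; rewrite lee_fin; lra.
Qed.

(** The menu pays exactly the fixed cost plus the integral of [p], so [excess_le_increment] applies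
    wherever [p] stays below the marginal value. The last hypothesis ensures this at levels reached
    with positive probability, which is enough almost surely. *)
Lemma buyer_payoff_ge (t p : R -> R) (q : n.-tuple R -> {nonneg R}) :
  regular_payment E t p ->
  (forall l : R, 0 <= l ->
     t l = \int[mu]_(s in `[0, l]) p s + expected_cost E 0 (worst E)) ->
  measurable_fun setT (fun w => (q (rtype E w))%:num) ->
  (forall l : R, 0 < l -> (0 < P [set w | (l <= (q (rtype E w))%:num)%R])%E ->
    p l <= hderive (value E) l) ->
  measurable_fun (`]0, +oo[ : set R) (fun l => ((Num.max (hderive (value E) l - p l) 0)%:E
            * P [set w | (l <= (q (rtype E w))%:num)%R])%E) /\
  (\int[mu]_(l in `]0%R, +oo[) ((Num.max (hderive (value E) l - p l) 0)%:E
      * P [set w | (l <= (q (rtype E w))%:num)%R])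
    - (expected_cost E 0 (worst E))%:E <= buyer_payoff E (M := menu t) q)%E.
Proof.
move=> hreg ht mq hpos.
have dV := value_diff hE.
pose Y w : R := (q (rtype E w))%:num.
have Y0 w : 0 <= Y w by rewrite /Y ge0.
have mp := regular_payment_measurable_price _ _ hreg.
have mD := measurable_hderive _ _ dV.
have cV := hderivable_within_continuous _ _ dV.
pose phi l : R := Num.max (hderive (value E) l - p l) 0.
have mphi : measurable_fun (`[0, +oo[ : set R) phi.
  by apply: measurable_maxr; [exact: measurable_funB|exact: measurable_cst].
have phi0 l : 0 <= phi l by rewrite le_max lexx orbT.
have [mA mB AB] := expectation_integral_upto _ _ _ P Y phi mq mphi phi0.
have mY (l : R) : measurable [set w | l <= Y w].
  rewrite (_ : [set _ | _] = setT `&` Y @^-1` `[l, +oo[); first exact: mq.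
  by rewrite setTI; apply/seteqP; split => w /=; rewrite in_itv /= andbT.
split => //; rewrite -AB /buyer_payoff unlock; apply: integral_ge_shift => //.
- apply: measurable_funB; first exact: measurable_comp_halfline.
  by apply: measurable_comp_halfline => //; exact: regular_payment_continuous _ _ hreg.
- by move=> w; apply: integral_ge0 => l _; rewrite lee_fin.
(* Almost surely every l below the delivered quantity is exceeded with positive
   probability: otherwise the quantity exceeds a rational of null survival. *)
pose F k := if unpickle k is Some r then
    [set w | ratr r <= Y w /\ P [set w' | (ratr r <= Y w')%R] = 0%E] else set0.
have negF k : P.-negligible (F k).
  rewrite /F; case: unpickle => [r|]; last exact: negligible_set0.
  have [Pr0|Prn0] := pselect (P [set w | (ratr r <= Y w)%R] = 0%E).
    by exists [set w | ratr r <= Y w]; split => // w [].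
  by rewrite (_ : [set _ | _] = set0); [exact: negligible_set0|apply/seteqP; split => // w []].
have [N [mN N0 FN]] := negligible_bigcup negF.
exists N; split => // w nw; apply: FN.
apply: contrapT => nF; apply: nw => /=.
have pD l : 0 < l < Y w -> p l <= hderive (value E) l.
  move=> /andP[l0 lY]; apply: hpos => //; rewrite lt0e measure_ge0 andbT.
  apply/eqP => Pl0; apply: nF.
  have [r /[!in_itv] /= /andP[lr rY]] := rat_in_itvoo lY.
  exists (pickle r); first exact: I.
  rewrite /F pickleK; split; first exact: ltW.
  apply/eqP; rewrite eq_le measure_ge0 andbT -Pl0; apply: measure_subset => //.
  by move=> w' /=; apply: le_trans; exact: ltW.
have sub : `[0, Y w]%classic `<=` (`[0, +oo[%classic : set R).
  by move=> x /=; rewrite !in_itv /= andbT => /andP[].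
have := @excess_le_increment R 0 (Y w) (value E) (hderive (value E)) p (Y0 w)
      (continuous_subspaceW sub cV) (measurable_funS (measurable_itv _) sub mD)
      (price_integrable hreg (Y0 w))
      (fun x xY => hderivable_right _ _ _ (ltW (andP xY).1) (dV x (ltW (andP xY).1))) pD.
rewrite (value0 hE) subr0 => H.
rewrite [(- _)%:E]EFinN leeBlDr // -EFinD; apply: (le_trans H); rewrite lee_fin (ht _ (Y0 w)); lra.
Qed.

End Procurement.

(** * Optimality of the menu by comparison at each quantity *)

Theorem theorem1 (R : realType) (d d' : measure_display)
    (Omega : measurableType d) (Wth : measurableType d')
    (P : probability Omega R) (n m : nat) (E : environment Wth P n)
    (hE : standing_assumptions E m)
    (p t : R -> R) (q : n.-tuple R -> {nonneg R})
    (hp : forall l : R, 0 <= l -> forall phat : R,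
       acceptance E l phat * (hderive (value E) l - phat)
       <= acceptance E l (p l) * (hderive (value E) l - p l))
    (ht : forall l : R, 0 <= l ->
       t l = \int[@lebesgue_measure R]_(s in `[0, l]) p s
             + expected_cost E 0 (worst E))
    (hreg : regular_payment E t p)
    (hq : forall x, types E x -> best_quantity E t x (q x)%:num)
    (hties : forall x (l : R), types E x -> best_quantity E t x l ->
       l <= (q x)%:num) :
  @optimal R d d' Omega Wth P n E (menu t) q.
Proof.
(* By [hties] the quantity [q x] is the largest maximizer, so being willing to produce [l] means
   delivering at least [l]. *)
have demandE (l : R) : 0 < l ->
    [set w | l <= (q (rtype E w))%:num] = [set w | marginal_cost E l (rtype E w) <= p l].
  move=> l0; apply/seteqP; split => w /=; have tw := rtype_in hE w.
    by move=> lq; apply/(seller_first_order hreg tw l0); exists (q (rtype E w))%:num => //; exact: hq.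
  move=> /(seller_first_order hreg tw l0)[q' lq' bq'].
  by apply: le_trans lq' _; exact: hties.
have mq : measurable_fun setT (fun w => (q (rtype E w))%:num).
  apply: measurable_fun_superlevel => l; have [l0|l0] := leP l 0.
    rewrite (_ : [set _ | _] = setT) //; apply/seteqP; split => // w _ /=.
    by rewrite (le_trans l0) // ge0.
  by rewrite demandE //; exact: acceptance_measurable hE _ _ (ltW l0).
have acceptE (l : R) : 0 < l ->
    P [set w | l <= (q (rtype E w))%:num] = (acceptance E l (p l))%:E.
  move=> l0; rewrite demandE // /acceptance fineK //.
  by apply: fin_num_measure; exact: acceptance_measurable hE _ _ (ltW l0).
split.
  split.
  - split => //; apply: (measurable_comp_halfline _ _ _ t (fun w => (q (rtype E w))%:num)) => //.
    exact: regular_payment_continuous hE _ _ hreg.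
  - exact: best_quantity_menu.
  (* Delivering 0 already pays the worst type's fixed cost, which covers that of every type. *)
  - move=> x tx; have [_ /(_ 0 (lexx _))] := hq x tx; rewrite /seller_utility.
    rewrite (ht 0) // set_itv1 Rintegral_set1 add0r; apply: le_trans.
    by rewrite subr_ge0; exact: expected_cost0_le_worst hE _ tx.
  - by exists t, p; split => // x tx; split => //; exact: hq.
move=> M s fs.
have [p' [ip' acc' mB' le']] := buyer_payoff_le hE _ _ fs.
have [|mB ge'] := buyer_payoff_ge hE t p q hreg ht mq.
  move=> l l0; rewrite acceptE // lte_fin => acc0.
  (* The trial price equal to the marginal value earns 0, so the optimal margin is nonnegative
     wherever acceptance has positive probability. *)
  have := hp l (ltW l0) (hderive (value E) l); rewrite subrr mulr0.
  by rewrite pmulr_rge0 // subr_ge0.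
have key (l : R) : 0 < l ->
    ((Num.max (hderive (value E) l - p' l) 0)%:E *
       P [set w | (l <= (quantity (s (rtype E w)))%:num)%R] <=
     (Num.max (hderive (value E) l - p l) 0)%:E * P [set w | (l <= (q (rtype E w))%:num)%R])%E.
  move=> l0; rewrite acceptE //.
  have a0 : 0 <= acceptance E l (p l) by rewrite fine_ge0.
  have [D0|] := boolP (hderive (value E) l - p' l <= 0).
    have -> : Num.max (hderive (value E) l - p' l) 0 = (0 : R) by rewrite max_r.
    by rewrite mul0e -EFinM lee_fin mulr_ge0 // le_max lexx orbT.
  rewrite -ltNge => D0; rewrite max_l ?(ltW D0) //.
  (* With a positive margin, survival may be replaced by acceptance at [p' l]; then [p' l] is a
     trial price in the pricing formula. *)
  apply: (@le_trans _ _ ((hderive (value E) l - p' l)%:E * (acceptance E l (p' l))%:E)%E).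
    by rewrite lee_wpmul2l ?acc' // lee_fin ltW.
  rewrite -!EFinM lee_fin mulrC; apply: le_trans (hp l (ltW l0) (p' l)) _.
  by rewrite mulrC ler_wpM2r // le_max lexx.
apply: le_trans le' (le_trans _ ge'); apply: leeB => //.
apply: ge0_le_integral => //.
  by move=> l _; rewrite mule_ge0 // lee_fin le_max lexx orbT.
by move=> l /=; rewrite in_itv /= andbT; exact: key.
Qed.
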